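(* Let $k,r,n\ge1$. Given a closed subvariety $X\subset\mathbb{A}^n$ over $\mathbb{C}$ and $\overline{P}\in((\mathbb{C}^r)^k)^{\circ}$, there is an embedding $$\Delta^{k,r}_{\overline{P}}(X)\subset\mathbb{A}^{r\left(\binom{n+N_k}{n}-1\right)}.$$
   Context: For $\overline m\in\mathbb{C}^r$, $(\overline m)_j$ is its $j$-th coordinate. $((\mathbb{C}^r)^k)^{\circ}$ is the set of $(\overline{m_1},\ldots,\overline{m_k})\in(\mathbb{C}^r)^k$ with $\sum_{i\in S}\overline{m_i}\ne\overline0$ for every nonempty $S\subset\{1,\ldots,k\}$. Let $e_n(y_1,\ldots,y_k,x_1,\ldots,x_k)=\sum_{i_1+\cdots+i_k=n}\binom{y_1}{i_1}\cdots\binom{y_k}{i_k}x_1^{i_1}\cdots x_k^{i_k}$, with $\binom yi=y(y-1)\cdots(y-i+1)/i!$; for vectors $v_i\in V$ in place of the $x_i$, products are taken in $\mathrm{Sym}^nV$. Definition of $\Delta^{k,r}_{\overline P}(X)$ for $\overline P=(\overline{m_1},\ldots,\overline{m_k})$: embed $X$ as a closed subvariety of a finite-dimensional vector space $V$. For $N$ sufficiently large the morphism $$X^k\to\Big(\prod_{i=1}^N\mathrm{Sym}^iV\Big)^r,\qquad(v_1,\ldots,v_k)\mapsto\big(e_i((\overline{m_1})_j,\ldots,(\overline{m_k})_j,v_1,\ldots,v_k)\big)_{1\le i\le N,1\le j\le r}$$ is finite, and its image (a closed subvariety, with reduced structure) is independent of $N$ up to the coordinate projections, which are isomorphisms. This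 image is $\Delta^{k,r}_{\overline P}(X)$; it is independent of the embedding up to isomorphism. Definition of $N_k$: with $m_1,\ldots,m_k,x_1,\ldots,x_k$ indeterminates, let $$R_i=\mathbb{C}[m_1,\ldots,m_k]\Big[\Big\{\tfrac1{\sum_{s\in S}m_s}\Big\}_{\emptyset\ne S\subset\{1,\ldots,k\}}\Big]\big[\{e_j(m_1,\ldots,m_k,x_1,\ldots,x_k)\}_{1\le j\le i}\big].$$ $N_k$ is the least $i$ such that $R_i=R_{i+1}=R_{i+2}=\cdots$ (such $i$ exists). *)

(* Defs.v *)
From mathcomp Require Import all_boot all_order all_algebra.
From mathcomp Require Import mpoly.
From mathcomp Require Import classical_sets.

Set Implicit Arguments.
Unset Strict Implicit.
Unset Printing Implicit Defensive.

Import GRing.Theory.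
Local Open Scope classical_set_scope.
Local Open Scope ring_scope.

(* Affine n-space over F is 'rV[F]_n. A variety is a reduced, not necessarily
   irreducible, Zariski-closed set of points; F is meant to be an algebraically
   closed field of characteristic 0. *)

Definition closed_subvariety (F : fieldType) (n : nat) (X : set 'rV[F]_n) :=
  exists I : set {mpoly F[n]},
    X = [set x | forall p, I p -> p.@[x 0] = 0].

Definition polymap (F : fieldType) (n d : nat) (f : 'I_d -> {mpoly F[n]})
    (x : 'rV[F]_n) : 'rV[F]_d :=
  \row_i (f i).@[x 0].

Definition isomorphic (F : fieldType) (n d : nat)
    (X : set 'rV[F]_n) (Y : set 'rV[F]_d) :=
  exists (f : 'I_d -> {mpoly F[n]}) (g : 'I_n -> {mpoly F[d]}),
    [/\ forall x, X x -> Y (polymap f x),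
        forall y, Y y -> X (polymap g y),
        forall x, X x -> polymap g (polymap f x) = x
      & forall y, Y y -> polymap f (polymap g y) = y].

(* Existence of a closed embedding of X into affine d-space. *)
Definition embeds_in (F : fieldType) (n : nat) (X : set 'rV[F]_n) (d : nat) :=
  exists Y : set 'rV[F]_d, closed_subvariety Y /\ isomorphic X Y.

Definition gbin (F : fieldType) (y : F) (i : nat) : F :=
  (\prod_(l < i) (y - l%:R)) / i`!%:R.

Definition e (F : fieldType) (A : comAlgType F) (k n : nat)
    (y : 'I_k -> F) (x : 'I_k -> A) : A :=
  \sum_(i : {ffun 'I_k -> 'I_n.+1} | (\sum_s i s == n)%N)
    (\prod_s gbin (y s) (i s)) *: \prod_s x s ^+ i s.

Definition circ (F : fieldType) (k r : nat) (P : 'I_k -> 'rV[F]_r) :=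
  forall S : {set 'I_k}, S != finset.set0 -> \sum_(s in S) P s != 0.

(* For V = F^n, Sym V is {mpoly F[n]}, the a-th basis vector of V being 'X_a;
   sym1 is the inclusion of V = Sym^1 V. *)
Definition sym1 (F : fieldType) (n : nat) (v : 'rV[F]_n) : {mpoly F[n]} :=
  \sum_a v 0 a *: 'X_a.

(* The monomials of degree 1, ..., N index a basis of the product of the
   Sym^i V for 1 <= i <= N. *)
Definition symIndex (r n N : nat) : finType :=
  ('I_r * {m : 'X_{1..n < N.+1} | (0 < mdeg m)%N})%type.

Definition Phi (F : fieldType) (k r n N : nat) (P : 'I_k -> 'rV[F]_r)
    (v : 'I_k -> 'rV[F]_n) : 'rV[F]_#|symIndex r n N| :=
  \row_(c < #|symIndex r n N|) let: (j, m) := enum_val c in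
    (e (mdeg (val m)) (fun s => P s 0 j) (fun s => sym1 (v s)))@_(val m).

(* The image of X^k; the variety Delta is Delta N for N sufficiently large,
   computed in the given affine space containing X. *)
Definition Delta (F : fieldType) (k r n N : nat) (P : 'I_k -> 'rV[F]_r)
    (X : set 'rV[F]_n) : set 'rV[F]_#|symIndex r n N| :=
  [set Phi N P v | v in [set v : 'I_k -> 'rV[F]_n | forall s, X (v s)]].

Arguments Delta {F k r n} N P X.

(* The rings R_i live in K[x_1, ..., x_k] with K = F(m_1, ..., m_k). *)
Definition ratFun (F : fieldType) (k : nat) : fieldType :=
  {fraction {mpoly F[k]}}.

Definition mvar (F : fieldType) (k : nat) (s : 'I_k) : ratFun F k :=
  tofrac ('X_s : {mpoly F[k]}).

(* F[m_1, ..., m_k] localized at the subset sums. *)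
Definition locRing (F : fieldType) (k : nat) : set (ratFun F k) :=
  [set a | exists (p : {mpoly F[k]}) (t : {set 'I_k} -> nat),
     a = tofrac p / \prod_(S : {set 'I_k} | S != finset.set0)
                       (\sum_(s in S) mvar F s) ^+ t S].

Definition Rring (F : fieldType) (k d : nat) : set {mpoly (ratFun F k)[k]} :=
  [set f | exists q : {mpoly (ratFun F k)[d]},
     (forall m, locRing (q@_m)) /\
     f = q \mPo [tuple e j.+1 (@mvar F k) (fun s => 'X_s) | j < d]].

Arguments Rring F k d : clear implicits.

Definition Rstable (F : fieldType) (k i : nat) :=
  forall j, (i <= j)%N -> Rring F k i = Rring F k j.

(* N is the number N_k: the least i at which the chain R_i stabilizes. *)
Definition is_N (F : fieldType) (k N : nat) :=
  Rstable F k N /\ forall i, Rstable F k i -> (N <= i)%N.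

(* Main.v *)
Require Import Defs.
From mathcomp Require Import all_boot all_order all_algebra.
From mathcomp Require Import mpoly.
From mathcomp Require Import classical_sets reals complex.
From mathcomp Require Import ring zify.

Set Implicit Arguments.
Unset Strict Implicit.
Unset Printing Implicit Defensive.

Import GRing.Theory.
Local Open Scope ring_scope.
Local Open Scope complex_scope.

(** By Newton's identities e_i and the weighted power sums sum_s y_s v_s^i
    determine each other polynomially, and the power sums are linear in y; so
    Delta is unchanged, up to isomorphism, when the vectors P_s are multiplied
    by an invertible matrix g. Taking g generic, no subset sum of the P_s g
    vanishes in any coordinate, so the relations expressing e_i, i > N_k,
    through e_1, ..., e_(N_k) over the localized ring specialize at the weights
    P_s g. Hence Delta is isomorphic to the image Y of X^k under the
    e_i(P_s g, v), i <= N_k, whose coordinates are r times the monomials of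
    degree 1, ..., N_k in n variables.

    Y is Zariski closed because the map is finite: the weighted power sums of
    x_1, ..., x_k with nonvanishing subset sums of weights generate an ideal
    modulo which every x_s is nilpotent, so the polynomials in the coordinates
    of the v_s form a finite module over the polynomials in the map, and
    Nakayama's lemma produces a point over each point of the closure. *)

(** * Generating series and Newton's identities for [e] *)

Section Newton.

Lemma natf_neq0_pchar0 (F : fieldType) (F0 : [pchar F] =i pred0) n :
  (0 < n)%N -> (n%:R : F) != 0.
Proof.
by move=> n0; rewrite natf_neq0_pchar; apply/pnatP => // p _ _; rewrite inE /= F0.
Qed.

Variables (F : fieldType) (A : comAlgType F).
Hypothesis F0 : [pchar F] =i pred0.

Definition eq_upto n (p q : {poly A}) := forall i, (i <= n)%N -> p`_i = q`_i.

Lemma eq_uptoM n p1 q1 p2 q2 :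
  eq_upto n p1 q1 -> eq_upto n p2 q2 -> eq_upto n (p1 * p2) (q1 * q2).
Proof.
move=> h1 h2 i ile; rewrite !coefM; apply: eq_bigr => j _.
by rewrite h1 ?h2 // (leq_trans _ ile) // ?leq_subr // -ltnS.
Qed.

Lemma eq_uptoD n p1 q1 p2 q2 :
  eq_upto n p1 q1 -> eq_upto n p2 q2 -> eq_upto n (p1 + p2) (q1 + q2).
Proof. by move=> h1 h2 i ile; rewrite !coefD h1 ?h2. Qed.

Variables (k : nat) (y : 'I_k -> F) (x : 'I_k -> A).

Definition wpsum i : A := \sum_s y s *: x s ^+ i.

(** The binomial series of [(1 + x s * T) ^ (y s)], cut off after degree [N]. *)
Definition bin_poly N s : {poly A} :=
  \poly_(i < N.+1) (gbin (y s) i *: x s ^+ i).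

(** These binomial series multiply to the generating series of the [e n], and the cutoff does not
    affect coefficients up to [N]. *)
Lemma e_coef_bin_poly n N : (n <= N)%N ->
  e n y x = (\prod_s bin_poly N s)`_n.
Proof.
move=> nN; have -> : (\prod_s bin_poly N s)`_n = (\prod_s bin_poly n s)`_n.
  apply: (_ : eq_upto n _ _) => //.
  elim/big_ind2: _ => // [p1 q1 p2 q2|s _ i ile]; first exact: eq_uptoM.
  by rewrite !coef_poly !ltnS ile (leq_trans ile).
under eq_bigr => s _ do rewrite /bin_poly poly_def.
rewrite bigA_distr_bigA coef_sum /e big_mkcond; apply: eq_bigr => f _.
rewrite (eq_bigr (fun s => (gbin (y s) (f s) *: x s ^+ f s)%:P * 'X^(f s)));
  last by move=> s _; rewrite -mul_polyC.
rewrite [in RHS]big_split /= -(rmorph_prod (@polyC A)) -expr_sum coefCM coefXn.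
by rewrite [n == _]eq_sym; case: eqP => _; rewrite ?mulr1 ?mulr0 // scaler_prod.
Qed.

Lemma gbinS (a : F) i : gbin a i.+1 * i.+1%:R = gbin a i * (a - i%:R).
Proof.
have := natf_neq0_pchar0 F0 (fact_gt0 i); have := natf_neq0_pchar0 F0 (ltn0Sn i).
rewrite /gbin big_ord_recr /= factS natrM => *.
by field; rewrite nat1r; apply/andP.
Qed.

(** Coefficient of [T ^ n] in the differential equation [f' = (a z / (1 + z T)) f] satisfied by
    [f = (1 + z T) ^ a]. *)
Lemma gbin_rec (a : F) (z : A) n :
  (gbin a n.+1 *: z ^+ n.+1) *+ n.+1 =
  \sum_(j < n.+1) ((-1) ^+ j * (a *: z ^+ j.+1)) * (gbin a (n - j) *: z ^+ (n - j)).
Proof.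
elim: n => [|n IHn].
  rewrite big_ord1 expr0 mul1r subn0 mulr1n expr1 -scalerAr expr0 mulr1 scalerA.
  by rewrite -[gbin a 1]mulr1 gbinS subr0.
rewrite big_ord_recl expr0 mul1r subn0 -scalerAl -scalerAr expr1 -exprS scalerA.
rewrite -scaler_nat scalerA [_%:R * _]mulrC gbinS mulrBr scalerBl [a * _]mulrC.
congr (_ + _).
transitivity (- z * ((gbin a n.+1 *: z ^+ n.+1) *+ n.+1)).
  by rewrite -scaler_nat scalerA mulNr -scalerAr -exprS mulrC.
rewrite IHn mulr_sumr; apply: eq_bigr => j _; rewrite lift0 subSS mulrA.
congr (_ * _); rewrite -!scalerAr; congr (_ *: _).
by rewrite !exprS; ring.
Qed.

(** The logarithmic derivative of the generating series is the sum over [s] of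
    [y s x s / (1 + x s T)], whose coefficients are signed power sums; compare coefficients of
    [T ^ n]. *)
Lemma newton_e n :
  e n.+1 y x *+ n.+1 = \sum_(j < n.+1) (-1) ^+ j * wpsum j.+1 * e (n - j) y x.
Proof.
(* [S s] truncates [y s x s / (1 + x s T)]. The product is kept to degree [n.+1] because
   differentiation loses one degree. *)
pose S s : {poly A} := \poly_(j < n.+1) ((-1) ^+ j * (y s *: x s ^+ j.+1)).
have H : eq_upto n (\prod_s bin_poly n.+1 s)^`()
                   ((\sum_s S s) * \prod_s bin_poly n.+1 s).
  pose K (p q : {poly A}) := eq_upto n p^`() (q * p).
  suff : K (\prod_s bin_poly n.+1 s) (\sum_s S s) by [].
  apply: big_ind2 => [i _|p q r s Hp Hr|s _ i ile].
  - by rewrite derivC mul0r.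
  - move=> i ile; rewrite derivM.
    have -> : (q + s) * (p * r) = (q * p) * r + p * (s * r) by ring.
    apply: eq_uptoD i ile; apply: eq_uptoM => //.
  - rewrite coef_deriv coefM coef_poly !ltnS ile gbin_rec.
    apply: eq_bigr => j _; rewrite !coef_poly.
    have jn : (j < n.+1)%N by rewrite (leq_trans (ltn_ord j)).
    have -> : (i - j < n.+2)%N by rewrite ltnS leqW // (leq_trans (leq_subr _ _)).
    by rewrite jn.
have := H n (leqnn n); rewrite coef_deriv -e_coef_bin_poly // => ->.
rewrite coefM; apply: eq_bigr => j _; rewrite -e_coef_bin_poly; last first.
  by rewrite (leq_trans (leq_subr _ _)).
congr (_ * _); rewrite coef_sum /wpsum mulr_sumr; apply: eq_bigr => s _.
by rewrite coef_poly ltn_ord.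
Qed.

Lemma e0 : e 0 y x = 1.
Proof.
rewrite (@e_coef_bin_poly 0 0) //; elim/big_ind: _ => [|p q Hp Hq|s _].
- by rewrite coef1.
- by rewrite coefM big_ord1 Hp Hq mulr1.
- by rewrite coef_poly /= /gbin big_ord0 fact0 divr1 expr0 scale1r.
Qed.

End Newton.

(** * Functions that depend polynomially on given ones *)

Section PolyFun.

Variables (F : fieldType) (T : Type).

(** Maps are compared on the common parameter set [T], so a morphism between two images of [T] can
    be given without describing the images. *)
Definition polyfun d (th : T -> 'I_d -> F) (h : T -> F) :=
  exists q : {mpoly F[d]}, forall v, h v = q.@[th v].

Section Closure.
Variables (d : nat) (th : T -> 'I_d -> F).

Lemma polyfun_ext h1 h2 : h1 =1 h2 -> polyfun th h1 -> polyfun th h2.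
Proof. by move=> eqh [q hq]; exists q => v; rewrite -eqh. Qed.

Lemma polyfun_coord i : polyfun th (th^~ i).
Proof. by exists 'X_i => v; rewrite mevalXU. Qed.

Lemma polyfunC c : polyfun th (fun=> c).
Proof. by exists c%:MP => v; rewrite mevalC. Qed.

Lemma polyfunD h1 h2 :
  polyfun th h1 -> polyfun th h2 -> polyfun th (fun v => h1 v + h2 v).
Proof. by move=> [p hp] [q hq]; exists (p + q) => v; rewrite mevalD hp hq. Qed.

Lemma polyfunM h1 h2 :
  polyfun th h1 -> polyfun th h2 -> polyfun th (fun v => h1 v * h2 v).
Proof. by move=> [p hp] [q hq]; exists (p * q) => v; rewrite mevalM hp hq. Qed.

Lemma polyfunX h i : polyfun th h -> polyfun th (fun v => h v ^+ i).
Proof. by move=> [p hp]; exists (p ^+ i) => v; rewrite rmorphXn /= hp. Qed.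

Lemma polyfun_sum (I : Type) (r : seq I) (P : pred I) (h : I -> T -> F) :
  (forall i, P i -> polyfun th (h i)) ->
  polyfun th (fun v => \sum_(i <- r | P i) h i v).
Proof.
move=> hh; elim: r => [|i r IHr].
  by apply: polyfun_ext (polyfunC 0) => v; rewrite big_nil.
case Pi: (P i); last by apply: polyfun_ext IHr => v; rewrite big_cons Pi.
by apply: polyfun_ext (polyfunD (hh i Pi) IHr) => v; rewrite big_cons Pi.
Qed.

Lemma polyfun_prod (I : Type) (r : seq I) (P : pred I) (h : I -> T -> F) :
  (forall i, P i -> polyfun th (h i)) ->
  polyfun th (fun v => \prod_(i <- r | P i) h i v).
Proof.
move=> hh; elim: r => [|i r IHr].
  by apply: polyfun_ext (polyfunC 1) => v; rewrite big_nil.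
case Pi: (P i); last by apply: polyfun_ext IHr => v; rewrite big_cons Pi.
by apply: polyfun_ext (polyfunM (hh i Pi) IHr) => v; rewrite big_cons Pi.
Qed.

Variable n : nat.

Definition polyfun_mpoly (H : T -> {mpoly F[n]}) :=
  forall m, polyfun th (fun v => (H v)@_m).

Lemma polyfun_mpoly_ext H1 H2 :
  H1 =1 H2 -> polyfun_mpoly H1 -> polyfun_mpoly H2.
Proof. by move=> eqH hH m; apply: polyfun_ext (hH m) => v; rewrite eqH. Qed.

Lemma polyfun_mpolyC (p : {mpoly F[n]}) : polyfun_mpoly (fun=> p).
Proof. by move=> m; apply: polyfunC. Qed.

Lemma polyfun_mpolyD H1 H2 : polyfun_mpoly H1 -> polyfun_mpoly H2 ->
  polyfun_mpoly (fun v => H1 v + H2 v).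
Proof.
move=> h1 h2 m; apply: polyfun_ext (polyfunD (h1 m) (h2 m)) => v.
by rewrite mcoeffD.
Qed.

Lemma polyfun_mpolyM H1 H2 : polyfun_mpoly H1 -> polyfun_mpoly H2 ->
  polyfun_mpoly (fun v => H1 v * H2 v).
Proof.
move=> h1 h2 m; apply: polyfun_ext => [v|]; first by rewrite mcoeffM.
by apply: polyfun_sum => ? _; apply: polyfunM.
Qed.

Lemma polyfun_mpolyZ h H : polyfun th h -> polyfun_mpoly H ->
  polyfun_mpoly (fun v => h v *: H v).
Proof.
move=> hh hH m; apply: polyfun_ext (polyfunM hh (hH m)) => v.
by rewrite mcoeffZ.
Qed.

Lemma polyfun_mpolyX H i : polyfun_mpoly H -> polyfun_mpoly (fun v => H v ^+ i).
Proof.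
move=> hH; elim: i => [|i IHi]; first exact: polyfun_mpolyC.
by apply: polyfun_mpoly_ext (polyfun_mpolyM hH IHi) => v; rewrite exprS.
Qed.

Lemma polyfun_mpoly_sum (I : Type) (r : seq I) (P : pred I) H :
  (forall i, P i -> polyfun_mpoly (H i)) ->
  polyfun_mpoly (fun v => \sum_(i <- r | P i) H i v).
Proof.
move=> hH m; apply: (@polyfun_ext (fun v => \sum_(i <- r | P i) (H i v)@_m)).
  by move=> v; rewrite raddf_sum.
by apply: polyfun_sum => i Pi; apply: hH.
Qed.

Lemma polyfun_mpoly_prod (I : Type) (r : seq I) (P : pred I) H :
  (forall i, P i -> polyfun_mpoly (H i)) ->
  polyfun_mpoly (fun v => \prod_(i <- r | P i) H i v).
Proof.
move=> hh; elim: r => [|i r IHr].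
  by apply: polyfun_mpoly_ext (polyfun_mpolyC 1) => v; rewrite big_nil.
case Pi: (P i); last by apply: polyfun_mpoly_ext IHr => v; rewrite big_cons Pi.
by apply: polyfun_mpoly_ext (polyfun_mpolyM (hh i Pi) IHr) => v; rewrite big_cons Pi.
Qed.

Lemma polyfun_mpoly_comp l (H : 'I_l -> T -> {mpoly F[n]}) (q : {mpoly F[l]}) :
  (forall j, polyfun_mpoly (H j)) ->
  polyfun_mpoly (fun v => q \mPo [tuple H j v | j < l]).
Proof.
move=> hH; apply: polyfun_mpoly_ext => [v|]; first by rewrite comp_mpolyE.
apply: polyfun_mpoly_sum => m _; apply: polyfun_mpolyZ; first exact: polyfunC.
apply: polyfun_mpoly_prod => i _; apply: polyfun_mpolyX.
by apply: polyfun_mpoly_ext (hH i) => v; rewrite tnth_mktuple.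
Qed.

Variables (k : nat) (x : T -> 'I_k -> {mpoly F[n]}).

Lemma polyfun_e N y : (forall s, polyfun_mpoly (x^~ s)) ->
  polyfun_mpoly (fun v => e N y (x v)).
Proof.
move=> hx; apply: polyfun_mpoly_sum => i _.
apply: polyfun_mpolyZ; first exact: polyfunC.
by apply: polyfun_mpoly_prod => s _; apply: polyfun_mpolyX.
Qed.

Hypothesis F0 : [pchar F] =i pred0.

(** Since [e 0] is 1, the last power sum enters Newton's identity with coefficient [(-1) ^+ i], and
    the identity can be solved for it. *)
Lemma polyfun_wpsum_of_e y N :
  (forall i, (i <= N)%N -> polyfun_mpoly (fun v => e i y (x v))) ->
  forall i, (0 < i <= N)%N -> polyfun_mpoly (fun v => wpsum y (x v) i).
Proof.
move=> he; elim/ltn_ind => -[|i] // IHi /= iN.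
apply: (@polyfun_mpoly_ext (fun v => (-1) ^+ i * (e i.+1 y (x v) *+ i.+1 -
   \sum_(j < i) (-1) ^+ j * wpsum y (x v) j.+1 * e (i - j) y (x v)))).
  move=> v; rewrite newton_e // big_ord_recr /= addrAC subrr add0r subnn e0 //.
  by rewrite mulr1 mulrA -exprMn mulrNN mulr1 expr1n mul1r.
apply: polyfun_mpolyM; first exact: polyfun_mpolyC.
apply: polyfun_mpolyD.
  apply: (@polyfun_mpoly_ext (fun v => i.+1%:R *: e i.+1 y (x v))).
    by move=> v; rewrite scaler_nat.
  by apply: polyfun_mpolyZ; [exact: polyfunC | exact: he].
apply: (@polyfun_mpoly_ext (fun v => -1 *: 
   \sum_(j < i) (-1) ^+ j * wpsum y (x v) j.+1 * e (i - j) y (x v))).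
  by move=> v; rewrite scaleN1r.
apply: polyfun_mpolyZ; first exact: polyfunC.
apply: polyfun_mpoly_sum => j _; apply: polyfun_mpolyM; last first.
  by apply: he; rewrite (leq_trans (leq_subr _ _)) // ltnW.
apply: polyfun_mpolyM; first exact: polyfun_mpolyC.
by apply: IHi; rewrite ?ltnS //= (leq_trans _ iN) // ltnS ltnW.
Qed.

(** Newton's identity is solved for [e i.+1] by dividing by [i.+1], a unit in characteristic 0. *)
Lemma polyfun_e_of_wpsum y N :
  (forall i, (0 < i <= N)%N -> polyfun_mpoly (fun v => wpsum y (x v) i)) ->
  forall i, (i <= N)%N -> polyfun_mpoly (fun v => e i y (x v)).
Proof.
move=> hp; elim/ltn_ind => -[_ _|i IHi iN].
  by apply: polyfun_mpoly_ext (polyfun_mpolyC 1) => v; rewrite e0.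
apply: (@polyfun_mpoly_ext (fun v => (i.+1%:R)^-1 *:
   \sum_(j < i.+1) (-1) ^+ j * wpsum y (x v) j.+1 * e (i - j) y (x v))).
  move=> v; rewrite -newton_e // -scaler_nat scalerA mulVf ?scale1r //.
  exact: natf_neq0_pchar0.
apply: polyfun_mpolyZ; first exact: polyfunC.
apply: polyfun_mpoly_sum => j _; apply: polyfun_mpolyM; last first.
  by apply: IHi; rewrite ?ltnS ?leq_subr // (leq_trans (leq_subr _ _)) // ltnW.
apply: polyfun_mpolyM; first exact: polyfun_mpolyC.
by apply: hp; rewrite /= (leq_trans (ltn_ord j)).
Qed.

End Closure.
End PolyFun.

(** * Specializing relations with generic weights to numerical weights *)

Section Specialization.

Lemma map_mpoly_mPo (n k : nat) (R S : comNzRingType) (f : {rmorphism R -> S})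
    (lq : n.-tuple {mpoly R[k]}) (p : {mpoly R[n]}) :
  map_mpoly f (p \mPo lq) =
  map_mpoly f p \mPo [tuple map_mpoly f (tnth lq i) | i < n].
Proof.
elim/mpolyind: p => [|c m p _ _ IHp]; first by rewrite !(raddf0, comp_mpoly0).
rewrite !raddfD /= IHp comp_mpolyZ !map_mpolyZ comp_mpolyZ.
congr (_ *: _ + _); rewrite map_mpolyX !comp_mpolyX rmorph_prod /=.
by apply: eq_bigr => i _; rewrite rmorphXn tnth_mktuple.
Qed.

Lemma comp_mpoly_e (F : fieldType) k n i (y : 'I_k -> F) (x : 'I_k -> {mpoly F[n]}) :
  e i y (fun s => 'X_s : {mpoly F[k]}) \mPo [tuple x s | s < k] = e i y x.
Proof.
rewrite /e raddf_sum; apply: eq_bigr => f _; rewrite /= comp_mpolyZ rmorph_prod /=.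
congr (_ *: _); apply: eq_bigr => s _.
by rewrite rmorphXn /= comp_mpolyXU -tnth_nth tnth_mktuple.
Qed.

Variables (F : fieldType) (k : nat).

Definition gbin_univ (s : 'I_k) i : {mpoly F[k]} :=
  (i`!%:R)^-1 *: \prod_(l < i) ('X_s - l%:R).

(** Indeterminate weights are kept in a polynomial ring rather than its fraction field, so that this
    maps both to the generic [e] and to [e] at numerical weights. *)
Definition e_univ i : {mpoly {mpoly F[k]}[k]} :=
  \sum_(f : {ffun 'I_k -> 'I_i.+1} | (\sum_s f s == i)%N)
    (\prod_s gbin_univ s (f s)) *: \prod_s 'X_s ^+ f s.

Lemma map_e_univ (K : fieldType) (g : {rmorphism {mpoly F[k]} -> K}) i :
  map_mpoly g (e_univ i) = e i (fun s => g 'X_s) (fun s => 'X_s : {mpoly K[k]}).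
Proof.
have gb s j : g (gbin_univ s j) = gbin (g 'X_s) j.
  rewrite /gbin_univ /gbin -mul_mpolyC rmorphM /= mulrC; congr (_ * _).
    rewrite rmorph_prod; apply: eq_bigr => l _ /=.
    by rewrite rmorphB rmorph_nat.
  by rewrite -[LHS]/((g \o @mpolyC k F) _) fmorphV rmorph_nat.
rewrite raddf_sum; apply: eq_bigr => f _ /=; rewrite map_mpolyZ !rmorph_prod /=.
by congr (_ *: _); apply: eq_bigr => s _; rewrite ?gb // rmorphXn /= map_mpolyX.
Qed.

Variable mu : 'I_k -> F.

(** Membership in the local ring of the weight space at [mu]. *)
Definition regular_at (a : ratFun F k) :=
  exists q p : {mpoly F[k]}, q.@[mu] != 0 /\ tofrac q * a = tofrac p.

Lemma locRing_regular_at a :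
  (forall S : {set 'I_k}, S != finset.set0 -> \sum_(s in S) mu s != 0) ->
  locRing a -> regular_at a.
Proof.
move=> hmu [p [t ->]].
pose q : {mpoly F[k]} :=
  \prod_(S : {set 'I_k} | S != finset.set0) (\sum_(s in S) 'X_s) ^+ t S.
have q0 : q.@[mu] != 0.
  rewrite rmorph_prod /=; apply/prodf_neq0 => S S0; rewrite rmorphXn /=.
  rewrite expf_neq0 // raddf_sum /= (eq_bigr mu) ?hmu // => s _.
  by rewrite mevalXU.
exists q, p; split; first exact: q0.
have -> : \prod_(S : {set 'I_k} | S != finset.set0) (\sum_(s in S) mvar F s) ^+ t S
  = tofrac q.
  rewrite rmorph_prod /=; apply: eq_bigr => S _; rewrite rmorphXn /=; congr (_ ^+ _).
  by rewrite rmorph_sum.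
rewrite mulrC divfK // tofrac_eq0; apply: contraNneq q0 => ->.
by rewrite meval0.
Qed.

Lemma clear_denominators d (q : {mpoly (ratFun F k)[d]}) :
  (forall m, regular_at q@_m) ->
  exists (c : {mpoly F[k]}) (p : {mpoly {mpoly F[k]}[d]}),
    c.@[mu] != 0 /\ tofrac c *: q = map_mpoly (@tofrac {mpoly F[k]}) p.
Proof.
elim/mpolyind: q => [|a m q mq _ IHq] hq.
  by exists 1, 0; rewrite meval1 oner_neq0 scaler0 raddf0.
have hqm m' : regular_at q@_m'.
  have [<-|mm'] := eqVneq m m'.
    rewrite (memN_msupp_eq0 mq); exists 1, 0.
    by rewrite meval1 oner_neq0 mulr0 tofrac0.
  by have := hq m'; rewrite mcoeffD mcoeffZ mcoeffX (negPf mm') mulr0 add0r.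
have [c [p [c0 cp]]] := IHq hqm.
have := hq m; rewrite mcoeffD mcoeffZ mcoeffX eqxx mulr1 (memN_msupp_eq0 mq) addr0.
move=> [c' [p' [c'0 cp']]].
exists (c' * c), ((c * p') *: 'X_[m] + c' *: p).
split; first by rewrite mevalM mulf_neq0.
rewrite scalerDr [RHS]rmorphD /= !map_mpolyZ map_mpolyX -cp /= !tofracM -cp'.
rewrite !scalerA.
by congr (_ *: _ + _); rewrite mulrA [tofrac c * _]mulrC.
Qed.

(** By stability the generic [e i] is a polynomial in the first [Nk] over the localized ring. The
    denominators do not vanish at [mu], so after clearing them the weights can be evaluated at
    [mu]. *)
Lemma e_generated Nk i :
  (forall S : {set 'I_k}, S != finset.set0 -> \sum_(s in S) mu s != 0) ->
  Rstable F k Nk -> (Nk < i)%N ->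
  exists q : {mpoly F[Nk]}, e i mu (fun s => 'X_s : {mpoly F[k]}) =
    q \mPo [tuple e j.+1 mu (fun s => 'X_s : {mpoly F[k]}) | j < Nk].
Proof.
move=> hmu hst; case: i => // i Nki.
have Ri : Rring F k i.+1 (e i.+1 (@mvar F k) (fun s => 'X_s)).
  exists 'X_ord_max; split.
    move=> m; exists (m == U_(ord_max))%MM%:R, (fun=> 0%N).
    by rewrite big1 ?divr1 ?mcoeffX ?rmorph_nat 1?eq_sym // => S _; rewrite expr0.
  by rewrite comp_mpolyXU -tnth_nth tnth_mktuple.
move: Ri; rewrite -(hst _ (ltnW Nki)) => -[q [hq eq_q]].
have [c [p [c0 cp]]] := clear_denominators (fun m => locRing_regular_at hmu (hq m)).
have univ : c *: e_univ i.+1 = p \mPo [tuple e_univ j.+1 | j < Nk].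
  have inj : injective (map_mpoly (@tofrac {mpoly F[k]}) : 
      {mpoly {mpoly F[k]}[k]} -> {mpoly (ratFun F k)[k]}).
    move=> u v uv; apply/mpolyP => m; apply/eqP.
    by rewrite -tofrac_eq -!mcoeff_map_mpoly uv.
  have hL : [tuple map_mpoly (@tofrac {mpoly F[k]}) (tnth [tuple e_univ j.+1 | j < Nk] i)
        | i < Nk] = [tuple e j.+1 (@mvar F k) (fun s => 'X_s) | j < Nk].
    by apply: eq_from_tnth => j; rewrite !tnth_mktuple map_e_univ.
  apply: inj; rewrite map_mpolyZ map_e_univ map_mpoly_mPo -cp comp_mpolyZ hL.
  by rewrite -eq_q.
exists (c.@[mu]^-1 *: map_mpoly (meval mu) p).
have hX j : e j mu (fun s => 'X_s : {mpoly F[k]}) = map_mpoly (meval mu) (e_univ j).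
  rewrite map_e_univ; apply: eq_bigr => f _; congr (_ *: _).
  by apply: eq_bigr => s _; rewrite /= mevalXU.
rewrite comp_mpolyZ hX.
apply: (@scalerI _ _ c.@[mu] c0); rewrite scalerA divff // scale1r.
rewrite -map_mpolyZ univ map_mpoly_mPo.
by congr (_ \mPo _); apply: eq_from_tnth => j; rewrite !tnth_mktuple hX.
Qed.

Lemma polyfun_e_stable (T : Type) d (th : T -> 'I_d -> F) n
    (x : T -> 'I_k -> {mpoly F[n]}) Nk :
  (forall S : {set 'I_k}, S != finset.set0 -> \sum_(s in S) mu s != 0) ->
  Rstable F k Nk ->
  (forall i, (i <= Nk)%N -> polyfun_mpoly th (fun v => e i mu (x v))) ->
  forall i, polyfun_mpoly th (fun v => e i mu (x v)).
Proof.
move=> hmu hst he i; have [/he //|Nki] := leqP i Nk.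
have [q hq] := e_generated hmu hst Nki.
have h (j : 'I_Nk) : polyfun_mpoly th (fun v => e j.+1 mu (x v)).
  exact: he _ (ltn_ord j).
apply: polyfun_mpoly_ext (polyfun_mpoly_comp q h) => v.
transitivity (q \mPo [tuple e j.+1 mu (fun s => 'X_s : {mpoly F[k]}) | j < Nk]
  \mPo [tuple x v s | s < k]); last by rewrite -hq comp_mpoly_e.
rewrite [LHS]comp_mpolyE [X in _ = X \mPo _]comp_mpolyE raddf_sum; apply: eq_bigr => m _.
rewrite /= comp_mpolyZ rmorph_prod; congr (_ *: _); apply: eq_bigr => j _.
by rewrite /= rmorphXn !tnth_mktuple /= comp_mpoly_e.
Qed.

End Specialization.

(** * Nilpotency modulo weighted power sums in a filtered algebra *)

Section GradedRadical.

Variables (F : fieldType) (A : comAlgType F) (M : nat -> A -> Prop).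
Hypothesis M0 : forall d, M d 0.
Hypothesis MD : forall d a b, M d a -> M d b -> M d (a + b).
Hypothesis MM : forall d1 d2 a b, M d1 a -> M d2 b -> M (d1 + d2)%N (a * b).
Hypothesis MC : forall c : F, M 0 c%:A.

(** Degrees are tracked by the index: this plays the part of a homogeneous ideal in the Rees algebra
    of the filtration [M]. *)
Definition graded_ideal (I : nat -> A -> Prop) :=
  [/\ forall d, I d 0,
      forall d a b, I d a -> I d b -> I d (a + b)
    & forall d1 d2 a b, M d1 a -> I d2 b -> I (d1 + d2)%N (a * b)].

(* M d is the degree <= d part of a filtered algebra; z ^+ D lies in
   degree_shift M D when z is nilpotent in the associated graded algebra. *)
Definition degree_shift d a := if d is d'.+1 then M d' a else a = 0.

Lemma graded_ideal_shift : graded_ideal degree_shift.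
Proof.
split=> [[]|[|d] a b|d1 [|d2] a b] //=.
- by move=> -> ->; rewrite addr0.
- exact: MD.
- by move=> _ ->; rewrite mulr0; case: (d1 + 0)%N.
- by rewrite addnS; apply: MM.
Qed.

(** The ideal generated by [I] and [a], with [a] placed in degree 1: the cofactor has degree
    [d - 1], and in degree 0 it is forced to be 0. *)
Definition adjoin (I : nat -> A -> Prop) a d f :=
  exists u b, [/\ I d u, degree_shift d b & f = u + a * b].

Lemma graded_ideal_adjoin I a : graded_ideal I -> graded_ideal (adjoin I a).
Proof.
have [S0 SD SM] := graded_ideal_shift.
move=> [I0 ID IM]; split.
- by move=> d; exists 0, 0; rewrite mulr0 addr0.
- move=> d f1 f2 [u1 [b1 [Iu1 Sb1 ->]]] [u2 [b2 [Iu2 Sb2 ->]]].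
  exists (u1 + u2), (b1 + b2); split; [exact: ID | exact: SD | ring].
- move=> d1 d2 c f Mc [u [b [Iu Sb ->]]].
  exists (c * u), (c * b); split; [exact: IM | exact: SM | ring].
Qed.

Lemma adjoin_sub I a d f : I d f -> adjoin I a d f.
Proof.
have [S0 _ _] := graded_ideal_shift.
by move=> If; exists f, 0; rewrite mulr0 addr0.
Qed.

Lemma adjoin_mul I a d b : graded_ideal I -> M d b -> adjoin I a d.+1 (a * b).
Proof. by move=> [I0 _ _] Mb; exists 0, b; rewrite add0r. Qed.

Lemma gradedX z n : M 1 z -> M n (z ^+ n).
Proof.
move=> Mz; elim: n => [|n IHn]; first by rewrite expr0 -[1]scale1r; apply: MC.
by rewrite exprS -add1n; apply: MM.
Qed.

Lemma graded_sum (J : Type) (r : seq J) (P : pred J) (h : J -> A) d :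
  (forall j, P j -> M d (h j)) -> M d (\sum_(j <- r | P j) h j).
Proof. by move=> hh; elim/big_ind: _ => // a b; apply: MD. Qed.

Lemma graded_idealZ I (c : F) d a : graded_ideal I -> I d a -> I d (c *: a).
Proof. by move=> [_ _ IM] Ia; rewrite -mulr_algl; apply: (IM 0%N _ _ _ (MC c)). Qed.

(** Each factor [a] is traded for a power of [z]: if [z ^+ D = u + a * b] with [u] in [I], then
    [z ^+ D] times the remaining factors is an element of [I] plus a multiple of the product still
    containing [a]. *)
Lemma nilpotent_mod_product I z (l : seq A) :
  graded_ideal I -> M 1 z -> (forall a, a \in l -> M 1 a) ->
  (forall a, a \in l -> exists D, adjoin I a D (z ^+ D)) ->
  I (size l) (\prod_(a <- l) a) -> exists D, I D (z ^+ D).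
Proof.
move=> [I0 ID IM] Mz Ml hl Il.
suff H m : I (m + size l)%N (z ^+ m * \prod_(a <- l) a) -> exists D, I D (z ^+ D).
  by apply: (H 0%N); rewrite expr0 mul1r.
elim: l m Ml hl {Il} => [|a l IHl] m Ml hl.
  by rewrite big_nil mulr1 addn0; exists m.
rewrite big_cons /= => Ial.
have Ml' b : b \in l -> M 1 b by move=> bl; apply: Ml; rewrite inE bl orbT.
have [D [u [b [Iu Sb zD]]]] := hl a (mem_head a l).
apply: (IHl (m + D)%N) => // [c cl|].
  by apply: hl; rewrite inE cl orbT.
have -> : z ^+ (m + D) * \prod_(c <- l) c =
  (z ^+ m * \prod_(c <- l) c) * u + b * (z ^+ m * (a * \prod_(c <- l) c)).
  by rewrite exprD zD; ring.
have Mp : M (size l) (\prod_(c <- l) c).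
  elim: (l) Ml' => [|c l' IH] Ml'.
    by rewrite big_nil -[1]scale1r; apply: MC.
  rewrite big_cons /= -add1n; apply: MM; first by apply: Ml'; rewrite mem_head.
  by apply: IH => c' c'l; apply: Ml'; rewrite inE c'l orbT.
apply: ID.
  have -> : (m + D + size l = m + size l + D)%N by lia.
  by apply: IM => //; apply: MM => //; apply: gradedX.
case: D Sb {Iu zD} => [->|D Mb]; first by rewrite mul0r.
have -> : (m + D.+1 + size l = D + (m + (size l).+1))%N by lia.
exact: IM.
Qed.

Variables (J : finType) (x : J -> A).
Hypothesis Mx : forall s, M 1 (x s).

(** Multiplying the summands by [x s - x b] gives the sum for [i.+1] minus [x b] times the sum for
    [i], so the family over all [i] is preserved. *)
Lemma weighted_sum_mulsub I (S : {set J}) (w : J -> F) (B : seq J) :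
  graded_ideal I ->
  (forall i, I i.+1 (\sum_(s in S) w s *: x s ^+ i.+1)) ->
  forall i, I (i.+1 + size B)%N
    (\sum_(s in S) w s *: (x s ^+ i.+1 * \prod_(b <- B) (x s - x b))).
Proof.
move=> gI hI; have [I0 ID IM] := gI.
elim: B => [|b B IHB] i.
  rewrite addn0; under eq_bigr => s _ do rewrite big_nil mulr1.
  exact: hI.
have -> : \sum_(s in S) w s *: (x s ^+ i.+1 * \prod_(c <- b :: B) (x s - x c)) =
  \sum_(s in S) w s *: (x s ^+ i.+2 * \prod_(c <- B) (x s - x c)) +
  ((-1 : F) *: x b) * 
    \sum_(s in S) w s *: (x s ^+ i.+1 * \prod_(c <- B) (x s - x c)).
  rewrite mulr_sumr -big_split /=; apply: eq_bigr => s _.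
  rewrite -scalerAr -scalerDr; congr (_ *: _); rewrite big_cons !exprS scaleN1r.
  by ring.
rewrite /= addnS -addSn; apply: ID; first exact: IHB.
rewrite addSn -add1n; apply: IM; last exact: IHB.
by rewrite -mulr_algl; apply: (MM (MC _) (Mx b)).
Qed.

(* The common zero locus of the weighted power sums is the origin when no
   subset of the weights sums to zero: Lagrange interpolation gives
   x_u * \prod_(t != u) (x_u - x_t) = 0, and one may merge x_u with x_t. *)
Lemma nilpotent_mod_weighted_sums I (S : {set J}) (w : J -> F) u :
  graded_ideal I ->
  (forall B : {set J}, B \subset S -> B != finset.set0 -> \sum_(s in B) w s != 0) ->
  (forall i, I i.+1 (\sum_(s in S) w s *: x s ^+ i.+1)) ->
  u \in S -> exists D, I D (x u ^+ D).
Proof.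
have [n leSn] := ubnP #|S|.
elim: n => // n IHn in S I w u leSn * => gI hw hI uS.
have [I0 ID IM] := gI.
have M1 : M 0 1 by rewrite -[1]scale1r; apply: MC.
have Mopp a d : M d a -> M d (- a).
  by move=> Ma; rewrite -scaleN1r -mulr_algl; apply: (MM (MC _) Ma).
pose l := x u :: [seq x u - x t | t <- enum (S :\ u)].
apply: (@nilpotent_mod_product I (x u) l) => // [a|a|].
- rewrite inE => /orP[/eqP ->|/mapP[t _ ->]] //.
  by apply: MD => //; apply: Mopp.
- rewrite inE => /orP[/eqP ->|/mapP[t + ->]].
    by exists 1%N; rewrite expr1 -{2}[x u]mulr1; apply: adjoin_mul.
  rewrite mem_enum => /[dup] tSu /setD1P[tu tS].
  (* Modulo [x u - x t] the index [u] merges into [t] and the weights add; subset sums of [w'] over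
     [S :\ u] are subset sums of [w] over [S]. *)
  pose w' s := if s == t then w t + w u else w s.
  have w'E (B : {set J}) : t \notin B -> \sum_(s in B) w' s = \sum_(s in B) w s.
    move=> tB; apply: eq_bigr => s sB; rewrite /w'.
    by case: eqP => // st; rewrite st in sB; rewrite sB in tB.
  have gI' := graded_ideal_adjoin (x u - x t) gI.
  have [|||D hD] := IHn (S :\ u) (adjoin I (x u - x t)) w' t _ gI' _ _ tSu.
  + by rewrite (cardsD1 u) uS in leSn.
  + move=> B BS B0; have uB : u \notin B.
      by apply/negP => /(fintype.subsetP BS); rewrite !inE eqxx.
    have BS' : B \subset S by rewrite (fintype.subset_trans BS) // subD1set.
    have [tB|tB] := boolP (t \in B); last by rewrite w'E //; apply: hw.
    rewrite (big_setD1 t) //= w'E ?setD11 // /w' eqxx.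
    have := hw (u |: B); rewrite finset.subUset finset.sub1set uS BS' => /(_ isT).
    rewrite big_setU1 //= (big_setD1 t) //= addrCA addrA; apply.
    by apply/finset.set0Pn; exists u; rewrite finset.setU11.
  + move=> i.
    have -> : \sum_(s in S :\ u) w' s *: x s ^+ i.+1 =
      \sum_(s in S) w s *: x s ^+ i.+1 +
      (x u - x t) * (- w u *: \sum_(j < i.+1) x u ^+ (i - j) * x t ^+ j).
      rewrite -scalerAr -subrXX (big_setD1 u uS) /= !(big_setD1 t tSu) /=.
      rewrite {1}/w' eqxx.
      have -> : \sum_(s in (S :\ u) :\ t) w' s *: x s ^+ i.+1 =
                \sum_(s in (S :\ u) :\ t) w s *: x s ^+ i.+1.
        apply: eq_bigr => s; rewrite /w' !inE => /andP[/negPf -> _] //.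
      by rewrite scalerDl scalerBr !scaleNr; ring.
    have [_ ID' _] := gI'.
    apply: ID'; first exact: adjoin_sub.
    apply: adjoin_mul => //; rewrite -mulr_algl; apply: (MM (MC _) (d2 := i)).
    apply: graded_sum => j _.
    have ji : (j <= i)%N by rewrite -ltnS.
    rewrite -[X in M X _](subnK ji).
    by apply: MM; apply: gradedX.
  (* [x u ^+ D - x t ^+ D] is a multiple of [x u - x t], so nilpotency passes from [x t] to
     [x u]. *)
  exists D; have [_ ID' _] := gI'; rewrite -[x u ^+ D](subrK (x t ^+ D)).
  apply: ID' => //; rewrite subrXX; case: D {hD} => [|D].
    by rewrite big_ord0 mulr0; have [I'0 _ _] := gI'; apply: I'0.
  apply: adjoin_mul => //; apply: graded_sum => j _.
  have jD : (j <= D)%N by rewrite -ltnS.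
  rewrite -[X in M X _](subnK jD).
  by apply: MM; apply: gradedX.
- have wu : w u != 0.
    have := hw (finset.set1 u); rewrite finset.sub1set uS finset.big_set1; apply => //.
    by apply/finset.set0Pn; exists u; rewrite finset.set11.
  (* Once all factors [x s - x t] with [t != u] are multiplied in, only the term at [u] survives,
     and its weight is invertible. *)
  have := weighted_sum_mulsub (enum (S :\ u)) gI hI 0%N.
  rewrite (big_setD1 u uS) /= [X in _ + X]big1 ?addr0; last first.
    move=> t tSu; rewrite (big_rem t) ?mem_enum //= subrr mul0r mulr0.
    by rewrite scaler0.
  move=> /(graded_idealZ (w u)^-1 gI); rewrite scalerA mulVf // scale1r expr1.
  by rewrite add1n big_cons big_map /= size_map.
Qed.

End GradedRadical.

(** * Finite generation over a subring, by lowering degrees *)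

Section FiniteSpan.

Variables (F : fieldType) (p : nat) (G : {mpoly F[p]} -> Prop).
Hypothesis GD : forall a b, G a -> G b -> G (a + b).
Hypothesis GM : forall a b, G a -> G b -> G (a * b).
Hypothesis GC : forall c, G c%:MP.

(** Elements of [G] count as degree 0, whatever their degree as polynomials; this is the filtration
    to which the nilpotency result is applied. *)
Definition span_le d (f : {mpoly F[p]}) :=
  exists s : seq ({mpoly F[p]} * 'X_{1..p}),
    (forall t, t \in s -> G t.1 /\ (mdeg t.2 <= d)%N) /\
    f = \sum_(t <- s) t.1 * 'X_[t.2].

Lemma span_le0 d : span_le d 0.
Proof. by exists [::]; rewrite big_nil. Qed.

Lemma span_leD d a b : span_le d a -> span_le d b -> span_le d (a + b).
Proof.
move=> [s [hs ->]] [t [ht ->]]; exists (s ++ t); rewrite big_cat; split => // u.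
by rewrite mem_cat => /orP[/hs|/ht].
Qed.

Lemma span_leM d1 d2 a b : span_le d1 a -> span_le d2 b -> span_le (d1 + d2)%N (a * b).
Proof.
move=> [s [hs ->]] [t [ht ->]].
exists [seq (u.1 * v.1, (u.2 + v.2)%MM) | u <- s, v <- t]; split.
  move=> _ /allpairsP[[u v] /= [/hs [Gu ud] /ht [Gv vd] ->]] /=.
  by rewrite mdegD leq_add //; split => //; apply: GM.
rewrite big_allpairs_dep /= big_distrlr; apply: eq_bigr => u _; apply: eq_bigr => v _.
by rewrite mpolyXD mulrACA.
Qed.

Lemma span_leW d1 d2 f : (d1 <= d2)%N -> span_le d1 f -> span_le d2 f.
Proof.
move=> d12 [s [hs ->]]; exists s; split => // t /hs[Gt td].
by split => //; apply: leq_trans d12.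
Qed.

Lemma span_le_sum d (J : Type) (r : seq J) (P : pred J) (h : J -> {mpoly F[p]}) :
  (forall j, P j -> span_le d (h j)) -> span_le d (\sum_(j <- r | P j) h j).
Proof.
move=> hh; elim/big_ind: _ => // [|a b]; [exact: span_le0 | exact: span_leD].
Qed.

Lemma span_le_coef g d : G g -> span_le d g.
Proof.
move=> Gg; exists [:: (g, 0%MM)]; rewrite big_seq1 mpolyX0 mulr1; split => // t.
by rewrite inE => /eqP ->; rewrite mdeg0.
Qed.

Lemma span_leX m : span_le (mdeg m) 'X_[m].
Proof.
exists [:: (1, m)]; rewrite big_seq1 mul1r; split => // t.
by rewrite inE => /eqP ->; split => //=; rewrite -mpolyC1.
Qed.

(** With [D0] the largest of the [D], a monomial of degree above [p * D0] has an exponent above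
    [D0], and rewriting that power lowers the degree over [G]; finitely many monomials remain. *)
Lemma finite_span :
  (forall c : 'I_p, exists D, span_le D ('X_c ^+ D.+1)) ->
  exists E, forall f, exists g : 'X_{1..p < E.+1} -> {mpoly F[p]},
    (forall m, G (g m)) /\ f = \sum_m g m * 'X_[bmnm m].
Proof.
move=> /fin_all_exists[D hD]; pose D0 := (\max_c D c)%N.
have hD0 c : span_le D0 ('X_c ^+ D0.+1).
  have le : (D c <= D0)%N by apply: leq_bigmax.
  rewrite -(subnKC le) -addSn exprD; apply: span_leM => //.
  rewrite mpolyXn -[X in span_le X]mul1n -(mdeg1 c) -mdegMn; exact: span_leX.
pose E := (p * D0)%N; exists E => f.
have {f} [s [hs ->]] : span_le E f.
  rewrite [f]mpolyE; apply: span_le_sum => m _; rewrite -mul_mpolyC -[E]add0n.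
  apply: span_leM; first exact: span_le_coef.
  have [d] := ubnP (mdeg m); elim: d => // d IHd in m * => md.
  have [mE|Em] := leqP (mdeg m) E; first by apply: span_leW mE (span_leX m).
  have /existsP[c mc] : [exists c, (D0 < m c)%N].
    apply: contraLR Em; rewrite negb_exists -leqNgt mdegE => /forallP h.
    rewrite /E -[X in (_ <= X * _)%N](card_ord p) -sum_nat_const.
    by apply: leq_sum => c _; rewrite leqNgt.
  have le : (U_(c) *+ D0.+1 <= m)%MM.
    apply/mnm_lepP => c'; rewrite mulmnE mnm1E; case: eqP => [<-|_] //.
    by rewrite mul1n.
  have mdegm : mdeg m = (mdeg (m - U_(c) *+ D0.+1)%MM + D0.+1)%N.
    by rewrite -{1}(submK le) mdegD mdegMn mdeg1 mul1n.
  have [s [hs eqs]] : span_le (D0 + mdeg (m - U_(c) *+ D0.+1)%MM)%N 'X_[m].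
    rewrite -{2}(submK le) addmC mpolyXD -mpolyXn; apply: span_leM => //.
    exact: span_leX.
  rewrite eqs big_seq; apply: span_le_sum => t /hs[Gt td].
  rewrite -[E]add0n; apply: span_leM; first exact: span_le_coef.
  apply: IHd; apply: leq_ltn_trans td _.
  by move: md; rewrite mdegm addnS ltnS addnC.
exists (fun m => \sum_(t <- s | t.2 == bmnm m) t.1); split.
  move=> m; rewrite big_seq_cond; elim/big_ind: _ => // [|t /andP[/hs[]]//].
  by rewrite -mpolyC0.
under [RHS]eq_bigr => m _ do rewrite mulr_suml.
rewrite (exchange_big_dep predT) //= big_seq [RHS]big_seq; apply: eq_bigr => t ts.
have [_ td] := hs _ ts; rewrite -ltnS in td.
by rewrite (big_pred1 (BMultinom td)).
Qed.

End FiniteSpan.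

(** The power sums lie in [G], so they have degree 0 for [span_le G] and vanish in the associated
    graded algebra. Nilpotency of a variable there says that some [D]-th power of it has degree
    below [D], as [finite_span] asks. *)
Lemma mpoly_finite_over_weighted_sums (F : fieldType) (p : nat)
    (G : {mpoly F[p]} -> Prop) (J K : finType) (w : J -> F) (c : J -> K -> 'I_p) :
  (forall a b, G a -> G b -> G (a + b)) -> (forall a b, G a -> G b -> G (a * b)) ->
  (forall a, G a%:MP) ->
  (forall B : {set J}, B != finset.set0 -> \sum_(s in B) w s != 0) ->
  (forall j i, G (\sum_s w s *: 'X_(c s j) ^+ i.+1)) ->
  (forall a, exists s j, a = c s j) ->
  exists E, forall f, exists g : 'X_{1..p < E.+1} -> {mpoly F[p]},
    (forall m, G (g m)) /\ f = \sum_m g m * 'X_[bmnm m].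
Proof.
move=> GD GM GC hw hG hc; apply: finite_span => // a; have [s [j ->]] := hc a.
have S0 d : span_le G d 0 by apply: span_le0.
have SD d (a1 a2 : {mpoly F[p]}) :
  span_le G d a1 -> span_le G d a2 -> span_le G d (a1 + a2) by apply: span_leD.
have SM d1 d2 (a1 a2 : {mpoly F[p]}) :
  span_le G d1 a1 -> span_le G d2 a2 -> span_le G (d1 + d2)%N (a1 * a2).
  exact: span_leM.
have SC (b : F) : span_le G 0 (b%:A) by rewrite alg_mpolyC; apply: span_le_coef.
have SX s' : span_le G 1 ('X_(c s' j) : {mpoly F[p]}).
  by rewrite -[1%N](mdeg1 (c s' j)); apply: span_leX.
have := @nilpotent_mod_weighted_sums F _ (span_le G) S0 SD SM SC J
  (fun s' => 'X_(c s' j)) SX (degree_shift (span_le G)) finset.setT w s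
  (graded_ideal_shift S0 SD SM).
case=> [B _|i||[|D]]; first exact: hw.
- rewrite /=; apply: span_le_coef => //.
  by under eq_bigl do rewrite finset.in_setT.
- by rewrite finset.in_setT.
(* Here [D = 0], where [degree_shift] contains only 0, so that 1 would be 0. *)
- by rewrite /= expr0 => /eqP; rewrite oner_eq0.
by move=> hD; exists D.
Qed.

(** * A Nullstellensatz for ideals modulo which every variable is algebraic *)

Section PolynomialIdeals.

Variables (F : closedFieldType) (p : nat).
Implicit Types (I J : {mpoly F[p]} -> Prop) (f g : {mpoly F[p]}).

Definition is_ideal I :=
  [/\ I 0, forall f g, I f -> I g -> I (f + g) & forall f g, I g -> I (f * g)].

Lemma ideal_sub_eval I (al : 'I_p -> F) : is_ideal I ->
  (forall c, I ('X_c - (al c)%:MP)) -> forall f, I (f - f.@[al]%:MP).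
Proof.
move=> [I0 ID IM] hX.
have hD f g : I (f - f.@[al]%:MP) -> I (g - g.@[al]%:MP) ->
    I (f + g - (f + g).@[al]%:MP).
  by move=> hf hg; rewrite mevalD mpolyCD opprD addrACA; apply: ID.
have hM f g : I (f - f.@[al]%:MP) -> I (g - g.@[al]%:MP) ->
    I (f * g - (f * g).@[al]%:MP).
  move=> hf hg; rewrite mevalM mpolyCM.
  rewrite (_ : _ - _ = f * (g - g.@[al]%:MP) + g.@[al]%:MP * (f - f.@[al]%:MP));
    last ring.
  by apply: ID; apply: IM.
have hC a : I (a%:MP - (a%:MP).@[al]%:MP) by rewrite mevalC subrr.
have h1 : I (1 - (1 : {mpoly F[p]}).@[al]%:MP) by rewrite -mpolyC1.
move=> f; elim/mpolyind: f => [|a m f _ _ IHf]; first by rewrite -mpolyC0.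
apply: hD => //; rewrite -mul_mpolyC; apply: (hM) => //; rewrite mpolyXE_id.
apply: (big_ind (fun g => I (g - g.@[al]%:MP))) => [//|f' g'|c _].
  exact: hM.
elim: (m c) => [|n IHn]; first by rewrite expr0.
by rewrite exprS; apply: hM => //; rewrite mevalXU.
Qed.

Lemma mpoly_sub_eval (al : 'I_p -> F) f :
  exists b, f - f.@[al]%:MP = \sum_c ('X_c - (al c)%:MP) * b c.
Proof.
apply: (@ideal_sub_eval (fun f => exists b, f = \sum_c ('X_c - (al c)%:MP) * b c)).
  split=> [|g h [b ->] [b' ->]|g h [b ->]].
  - by exists (fun=> 0); rewrite big1 // => c _; rewrite mulr0.
  - exists (fun c => b c + b' c); rewrite -big_split; apply: eq_bigr => c _.
    by rewrite mulrDr.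
  - by exists (fun c => g * b c); rewrite mulr_sumr; apply: eq_bigr => c _; ring.
move=> c; exists (fun c' => (c' == c)%:R); rewrite (bigD1 c) //= eqxx mulr1.
by rewrite big1 ?addr0 // => c' /negPf ->; rewrite mulr0.
Qed.

Definition ideal_adjoin I g f := exists u b, I u /\ f = u + g * b.

Lemma is_ideal_adjoin I g : is_ideal I -> is_ideal (ideal_adjoin I g).
Proof.
move=> [I0 ID IM]; split=> [|f1 f2 [u1 [b1 [Iu1 ->]]] [u2 [b2 [Iu2 ->]]]|f h].
- by exists 0, 0; rewrite mulr0 addr0.
- by exists (u1 + u2), (b1 + b2); split; [exact: ID | ring].
- by move=> [u [b [Iu ->]]]; exists (f * u), (f * b); split; [exact: IM | ring].
Qed.

(** If 1 lay in the ideal generated by [I] and [g] for every factor [g], multiplying these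
    expressions would put 1 in the ideal generated by [I] and the product, which is [I]. *)
Lemma proper_adjoin_factor I (l : seq {mpoly F[p]}) : is_ideal I -> ~ I 1 ->
  I (\prod_(g <- l) g) -> exists2 g, g \in l & ~ ideal_adjoin I g 1.
Proof.
move=> [I0 ID IM] I1 Il; apply: boolp.contrapT => hl; apply: I1.
have {}hl g : g \in l -> ideal_adjoin I g 1.
  by move=> gl; apply: boolp.contrapT => ng; apply: hl; exists g.
suff [u [b [Iu ->]]] : ideal_adjoin I (\prod_(g <- l) g) 1.
  by apply: ID => //; rewrite mulrC; apply: IM.
elim: l {Il} hl => [|g l IHl] hl.
  by exists 0, 1; rewrite big_nil mulr1 add0r.
have [u [b [Iu e1]]] := hl g (mem_head g l).
have [|u' [b' [Iu' e2]]] := IHl; first by move=> h hh; apply: hl; rewrite inE hh orbT.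
exists (u + g * b * u'), (b * b'); split; first by apply: ID => //; apply: IM.
rewrite big_cons {1}e1 -[b in LHS]mulr1 {1}e2; ring.
Qed.

(** Each polynomial satisfied by ['X_c] splits, and one of its linear factors can be adjoined
    without reaching 1. After all variables, every [f] is congruent to the constant [f.@[al]], which
    must be 0 when [f] is in [I]. *)
Lemma ideal_has_zero I : is_ideal I -> ~ I 1 ->
  (forall c : 'I_p, exists2 P : {poly F}, P != 0 & I (map_poly (@mpolyC p F) P).['X_c]) ->
  exists al : 'I_p -> F, forall f, I f -> f.@[al] = 0.
Proof.
move=> gI I1 halg.
have [J [gJ IJ J1 hJ]] : exists J, [/\ is_ideal J, forall f, I f -> J f, ~ J 1 &
    forall c, c \in enum 'I_p -> exists a : F, J ('X_c - a%:MP)].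
  elim: (enum 'I_p) => [|c l [J [gJ IJ J1 hJ]]]; first by exists I.
  have [P P0 IP] := halg c.
  have [r defP] := closed_field_poly_normal P.
  have [J0 JD JM] := gJ.
  have Jr : J (\prod_(g <- [seq 'X_c - z%:MP | z <- r]) g).
    rewrite big_map; have := JM (lead_coef P)^-1%:MP _ (IJ _ IP).
    rewrite {2}defP map_polyZ hornerZ /= mulrA -mpolyCM mulVf ?lead_coef_eq0 //.
    rewrite mpolyC1 mul1r rmorph_prod horner_prod /=.
    by under eq_bigr => z _ do rewrite map_polyXsubC hornerXsubC.
  have [_ /mapP[z _ ->] nz] := proper_adjoin_factor gJ J1 Jr.
  exists (ideal_adjoin J ('X_c - z%:MP)); split => //.
  - exact: is_ideal_adjoin.
  - by move=> f /IJ Jf; exists f, 0; rewrite mulr0 addr0.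
  - move=> c'; rewrite inE => /orP[/eqP ->|/hJ[a Ja]].
      by exists z, 0, 1; rewrite add0r mulr1.
    by exists a, ('X_c' - a%:MP), 0; rewrite mulr0 addr0.
have /fin_all_exists[al hal] c : exists a : F, J ('X_c - a%:MP).
  by apply: hJ; rewrite mem_enum.
exists al => f /IJ Jf; apply: boolp.contrapT => /eqP fal; apply: J1.
have [J0 JD JM] := gJ.
have := ideal_sub_eval gJ hal f => /(JM (-1)) Jsub.
have := JM ((f.@[al])^-1)%:MP _ (JD _ _ Jf Jsub).
rewrite mulN1r opprB addrCA subrr addr0 -mpolyCM mulVf //.
Qed.

End PolynomialIdeals.

(** * Closedness of the image of a finite map *)

Section FiniteImage.

Variables (F : closedFieldType) (T : Type) (Z : T -> Prop) (p d L : nat).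
Variables (x : T -> 'I_p -> F) (phi : T -> 'I_d -> F).
Variables (f : 'I_d -> {mpoly F[p]}) (h : 'I_L -> {mpoly F[p]}).
Hypothesis phiE : forall z i, phi z i = (f i).@[x z].
Hypothesis h_span : forall g : {mpoly F[p]}, exists q : 'I_L -> {mpoly F[d]},
  forall z, g.@[x z] = \sum_m (q m).@[phi z] * (h m).@[x z].
Hypothesis Z_closed : forall al : 'I_p -> F,
  (forall q : {mpoly F[p]}, (forall z, Z z -> q.@[x z] = 0) -> q.@[al] = 0) ->
  exists2 z, Z z & x z =1 al.
Variable y : 'I_d -> F.
Hypothesis y_closure : forall q : {mpoly F[d]},
  (forall z, Z z -> q.@[phi z] = 0) -> q.@[y] = 0.

(** The pullback of the ideal that the maximal ideal of [y] generates in the functions on [Z]; it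
    cuts out the fibre of [phi] over [y]. *)
Definition fiber_ideal (g : {mpoly F[p]}) :=
  exists b : 'I_d -> {mpoly F[p]}, forall z, Z z ->
    g.@[x z] = \sum_i (phi z i - y i) * (b i).@[x z].

Lemma is_ideal_fiber_ideal : is_ideal fiber_ideal.
Proof.
split=> [|g1 g2 [b1 h1] [b2 h2]|g1 g2 [b hb]].
- by exists (fun=> 0) => z _; rewrite meval0 big1 // => i _; rewrite ?meval0 mulr0.
- exists (fun i => b1 i + b2 i) => z Zz; rewrite mevalD h1 // h2 // -big_split.
  by apply: eq_bigr => i _; rewrite mevalD mulrDr.
- exists (fun i => g1 * b i) => z Zz; rewrite mevalM hb // mulr_sumr.
  by apply: eq_bigr => i _; rewrite mevalM mulrCA.
Qed.

(* Nakayama: if 1 lay in the fiber ideal, the generators h would be killed by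
   the value at phi z of a matrix congruent to 1 modulo the ideal of y. *)
Lemma fiber_ideal_proper : ~ fiber_ideal 1.
Proof.
move=> [b hb].
have /fin_all_exists[Q hQ] i : exists Q : 'I_L -> 'I_L -> {mpoly F[d]},
    forall m z, (b i * h m).@[x z] = \sum_m' (Q m m').@[phi z] * (h m').@[x z].
  exact: (@fin_all_exists _ _ (fun m Q => forall z,
    (b i * h m).@[x z] = \sum_m' (Q m').@[phi z] * (h m').@[x z])).
pose N := \matrix_(m' < L, m < L)
  ((m == m')%:R - \sum_i ('X_i - (y i)%:MP) * Q i m m' : {mpoly F[d]}).
have /eqP : (\det N).@[y] = 0.
  apply: y_closure => z Zz; rewrite -[LHS](det_map_mx (meval (phi z))).
  apply/eqP/det0P; exists (\row_m (h m).@[x z]).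
    have [q hq] := h_span 1; apply: contra_eqN (hq z) => /eqP h0.
    rewrite meval1 big1 ?oner_eq0 // => m _.
    by move/rowP/(_ m): h0; rewrite !mxE => ->; rewrite mulr0.
  apply/rowP => m; rewrite !mxE.
  under eq_bigr => m' _ do rewrite !mxE /= mevalB mulrBr.
  rewrite sumrB (bigD1 m) //= eqxx meval1 mulr1 [X in _ + X - _]big1 ?addr0; last first.
    by move=> m' /negPf; rewrite eq_sym => ->; rewrite meval0 mulr0.
  apply/eqP; rewrite subr_eq0; apply/eqP.
  rewrite -[LHS]mul1r -(meval1 (x z)) hb // mulr_suml.
  under [RHS]eq_bigr => m' _ do rewrite raddf_sum mulr_sumr.
  rewrite exchange_big; apply: eq_bigr => i _ /=.
  rewrite -mulrA -mevalM hQ mulr_sumr; apply: eq_bigr => m' _.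
  by rewrite mevalM mevalB mevalXU mevalC mulrA mulrC.
rewrite -(det_map_mx (meval y)) (_ : map_mx _ N = 1%:M) ?det1 ?oner_eq0 //.
apply/matrixP => m' m; rewrite !mxE /= mevalB rmorph_sum /= big1 ?subr0.
  by rewrite eq_sym; case: eqP => _; rewrite ?meval1 ?meval0.
by move=> i _; rewrite mevalM mevalB mevalXU mevalC subrr mul0r.
Qed.

(** Modulo the ideal of [y] all functions are spanned over [F] by the [L] elements [h m], so the
    [L.+1] powers of ['X_c] with exponents 0 to [L] are linearly dependent. *)
Lemma fiber_ideal_algebraic (c : 'I_p) :
  exists2 P : {poly F}, P != 0 & fiber_ideal (map_poly (@mpolyC p F) P).['X_c].
Proof.
have /fin_all_exists[q hq] (j : 'I_L.+1) := h_span ('X_c ^+ j).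
pose W := \matrix_(j < L.+1, m < L) (q j m).@[y].
have /rowV0Pn[u /sub_kermxP uW u0] : kermx W != 0.
  by rewrite kermx_eq0 /row_free neq_ltn ltnS rank_leq_col.
exists (rVpoly u); first by apply: contra_neq u0 => u0; rewrite -[u]rVpolyK u0 linear0.
pose r m := \sum_j u 0 j *: q j m.
have r0 m : (r m).@[y] = 0.
  move/rowP/(_ m): uW; rewrite !mxE => <-; rewrite raddf_sum; apply: eq_bigr => j _.
  by rewrite /= mevalZ !mxE.
have /fin_all_exists[b hb] m := mpoly_sub_eval y (r m).
exists (fun i => \sum_m (b m i \mPo [tuple f i | i < d]) * h m) => z Zz.
have -> : (map_poly (@mpolyC p F) (rVpoly u)).['X_c].@[x z] =
    \sum_m (r m).@[phi z] * (h m).@[x z].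
  transitivity (\sum_(j < L.+1) u 0 j * ('X_c ^+ j : {mpoly F[p]}).@[x z]).
    rewrite (@horner_coef_wide _ L.+1); last first.
      by rewrite size_map_poly (leq_trans (size_poly _ _)).
    rewrite raddf_sum; apply: eq_bigr => j _.
    by rewrite /= coef_map mevalM mevalC coef_rVpoly_ord.
  under eq_bigr => j _ do rewrite hq mulr_sumr.
  rewrite exchange_big; apply: eq_bigr => m _ /=.
  rewrite raddf_sum mulr_suml; apply: eq_bigr => j _.
  by rewrite /= mevalZ mulrA.
have phi_eta : phi z =1 fun i => (tnth [tuple f i | i < d] i).@[x z].
  by move=> i; rewrite tnth_mktuple phiE.
transitivity (\sum_m \sum_i (phi z i - y i) * (b m i).@[phi z] * (h m).@[x z]).
  apply: eq_bigr => m _; rewrite -mulr_suml; congr (_ * _).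
  have := hb m; rewrite r0 subr0 => ->; rewrite raddf_sum; apply: eq_bigr => i _.
  by rewrite /= mevalM mevalB mevalXU mevalC.
rewrite exchange_big; apply: eq_bigr => i _; rewrite raddf_sum mulr_sumr.
apply: eq_bigr => m _.
by rewrite /= mevalM comp_mpoly_meval -(meval_eq _ phi_eta) mulrA.
Qed.

(** A zero of the fibre ideal comes from a point of [Z], since the ideal contains all polynomials
    vanishing on [Z], and it lies over [y], since the ideal contains each [f i - y i]. *)
Lemma finite_image_closed : exists2 z, Z z & phi z =1 y.
Proof.
have [al hal] := ideal_has_zero is_ideal_fiber_ideal fiber_ideal_proper
  fiber_ideal_algebraic.
have [q hq|z Zz xz] := Z_closed (al := al).
  apply: hal; exists (fun=> 0) => z Zz; rewrite hq // big1 // => i _.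
  by rewrite ?meval0 mulr0.
exists z => // i; rewrite phiE (meval_eq _ xz).
apply/eqP; rewrite -subr_eq0; apply/eqP; rewrite -[y i](mevalC al) -mevalB.
apply: hal; exists (fun i' => (i' == i)%:R) => z' _.
rewrite mevalB mevalC -phiE (bigD1 i) //= eqxx meval1 mulr1 big1 ?addr0 //.
by move=> i' /negPf ->; rewrite meval0 mulr0.
Qed.

End FiniteImage.

(** * Generic change of basis for the weights *)

Lemma poly_neq0_eventually (F : fieldType) (P : {poly F}) :
  [pchar F] =i pred0 -> P != 0 ->
  exists N, forall n, (N <= n)%N -> P.[n%:R] != 0.
Proof.
move=> F0; have [d] := ubnP (size P); elim: d P => // d IHd P sP P0.
have [[n0 rP]|nr] := boolp.pselect (exists n : nat, root P n%:R); last first.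
  by exists 0%N => n _; apply/negP => rP; apply: nr; exists n.
have /factor_theorem[Q PQ] := rP.
have Q0 : Q != 0 by apply: contra_neq P0 => Q0; rewrite PQ Q0 mul0r.
have [|N hN] := IHd Q _ Q0.
  by move: sP; rewrite PQ size_Mmonic ?monicXsubC // size_XsubC addnS addn1.
exists (maxn N n0.+1) => n; rewrite geq_max => /andP[/hN Qn n0n].
rewrite PQ hornerM hornerXsubC mulf_neq0 //.
by rewrite -natrB 1?ltnW // natf_neq0_pchar0 ?subn_gt0.
Qed.

(** The columns of [g] lie on the moment curve at the nodes [N + j]: the coordinates of [u *m g] are
    values of the polynomial with coefficients [u], nonzero for large [N], and distinct nodes make
    the Vandermonde matrix invertible. *)
Lemma exists_generic_basis (F : fieldType) r (U : seq 'rV[F]_r) :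
  [pchar F] =i pred0 -> (forall u, u \in U -> u != 0) ->
  exists g : 'M[F]_r, g \in unitmx /\ forall u j, u \in U -> (u *m g) 0 j != 0.
Proof.
move=> F0 hU.
have [N hN] : exists N, forall n, (N <= n)%N -> forall u, u \in U ->
    (rVpoly u).[n%:R] != 0.
  elim: U hU => [|u U IHU] hU; first by exists 0%N.
  have [|N hN] := IHU; first by move=> v vU; apply: hU; rewrite inE vU orbT.
  have u0 : rVpoly u != 0.
    by apply: contra_neq (hU u (mem_head u U)) => u0; rewrite -[u]rVpolyK u0 linear0.
  have [N' hN'] := poly_neq0_eventually F0 u0.
  exists (maxn N N') => n; rewrite geq_max => /andP[Nn N'n] v.
  by rewrite inE => /orP[/eqP ->|vU]; [apply: hN' | apply: hN].
pose a : 'rV[F]_r := \row_j (N + j)%:R.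
exists (Vandermonde r a); split.
  rewrite unitmxE det_Vandermonde unitfE; apply/prodf_neq0 => i _.
  apply/prodf_neq0 => j ij; rewrite !mxE -natrB ?leq_add2l 1?ltnW //.
  by rewrite natf_neq0_pchar0 // subn_gt0 ltn_add2l.
move=> u j uU; have := hN (N + j)%N (leq_addr _ _) u uU.
congr (_ != _); rewrite (horner_coef_wide _ (size_poly _ _)) mxE.
by apply: eq_bigr => i _; rewrite coef_rVpoly_ord !mxE.
Qed.

(** * Dependence of [e] and [Phi] on the weights *)

Section SymmetricCoordinates.

Variables (F : fieldType) (n : nat).

Lemma sym1_homog (v : 'rV[F]_n) : sym1 v \is 1.-homog.
Proof. by apply: rpred_sum => a _; apply: rpredZ; rewrite dhomogX /= mdeg1. Qed.

Lemma e_sym1_homog k i (y : 'I_k -> F) (v : 'I_k -> 'rV[F]_n) :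
  e i y (fun s => sym1 (v s)) \is i.-homog.
Proof.
apply: rpred_sum => f /eqP fi; apply: rpredZ.
suff: \prod_s sym1 (v s) ^+ f s \is (\sum_s f s)%N.-homog by rewrite fi.
pose K (p : {mpoly F[n]}) d := p \is d.-homog.
apply: (big_ind2 K) => [|p1 d1 p2 d2|s _]; [exact: dhomog1 | exact: dhomogM |].
by have := dhomogMn (f s) (sym1_homog (v s)); rewrite mul1n.
Qed.

Lemma wpsum_sym1_homog k i (y : 'I_k -> F) (v : 'I_k -> 'rV[F]_n) :
  wpsum y (fun s => sym1 (v s)) i \is i.-homog.
Proof.
apply: rpred_sum => s _; apply: rpredZ.
by have := dhomogMn i (sym1_homog (v s)); rewrite mul1n.
Qed.

(** Homogeneity of a fixed degree bounds the support uniformly in [v], so evaluation is one finite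
    sum of coefficients. *)
Lemma polyfun_meval (T : Type) d (th : T -> 'I_d -> F) (H : T -> {mpoly F[n]}) i u :
  (forall v, H v \is i.-homog) -> polyfun_mpoly th H ->
  polyfun th (fun v => (H v).@[u]).
Proof.
move=> hi hH.
apply: (@polyfun_ext _ _ _ _
  (fun v => \sum_(m : 'X_{1..n < i.+1}) (H v)@_m * ('X_[m]).@[u])).
  move=> v; have /mpolywE{2}-> : (msize (H v) <= i.+1)%N; last first.
    by rewrite raddf_sum; apply: eq_bigr => m _; rewrite /= mevalZ.
  rewrite msizeE; apply/bigmax_leqP_seq => m mH _.
  by rewrite (dhomog_mf (hi v) mH).
by apply: polyfun_sum => m _; apply: polyfunM; [exact: hH | exact: polyfunC].
Qed.

Variables (k r : nat).

(** [Phi] stores the coefficients of [e i] in degree [i]; by homogeneity the others are 0. *)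
Lemma polyfun_e_Phi N (P : 'I_k -> 'rV[F]_r) i j : (i <= N)%N ->
  polyfun_mpoly (fun v => Phi N P v 0)
    (fun v : 'I_k -> 'rV[F]_n => e i (fun s => P s 0 j) (fun s => sym1 (v s))).
Proof.
case: i => [_|i iN].
  by apply: polyfun_mpoly_ext (polyfun_mpolyC _ 1) => v; rewrite e0.
move=> m; have [mi|mi] := eqVneq (mdeg m) i.+1; last first.
  apply: polyfun_ext (polyfunC _ 0) => v.
  by rewrite (dhomog_nemf_coeff (e_sym1_homog _ _ _) mi).
have hm : (mdeg m < N.+1)%N by rewrite mi.
have hm' : (0 < mdeg (BMultinom hm))%N by rewrite /= mi.
pose c : symIndex r n N := (j, exist _ (BMultinom hm) hm').
apply: polyfun_ext (polyfun_coord _ (enum_rank c)) => v.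
by rewrite mxE enum_rankK /= mi.
Qed.

Lemma polyfun_Phi N (P : 'I_k -> 'rV[F]_r) (T : Type) d (th : T -> 'I_d -> F)
    (x : T -> 'I_k -> 'rV[F]_n) :
  (forall i j, (i <= N)%N ->
    polyfun_mpoly th (fun v => e i (fun s => P s 0 j) (fun s => sym1 (x v s)))) ->
  forall c, polyfun th (fun v => Phi N P (x v) 0 c).
Proof.
move=> he c.
case Ec: (enum_val c) => [j m].
apply: (@polyfun_ext _ _ _ _
  (fun v => (e (mdeg (val m)) (fun s => P s 0 j) (fun s => sym1 (x v s)))@_(val m))).
  by move=> v; rewrite mxE Ec.
by apply: he; rewrite -ltnS bmdeg.
Qed.

Lemma wpsum_mulmx (P : 'I_k -> 'rV[F]_r) (g : 'M[F]_r) (x : 'I_k -> {mpoly F[n]}) j i :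
  wpsum (fun s => (P s *m g) 0 j) x i = \sum_l g l j *: wpsum (fun s => P s 0 l) x i.
Proof.
rewrite /wpsum; under [RHS]eq_bigr => l _ do rewrite scaler_sumr.
rewrite exchange_big; apply: eq_bigr => s _ /=; rewrite mxE scaler_suml.
by apply: eq_bigr => l _; rewrite scalerA mulrC.
Qed.

Hypothesis F0 : [pchar F] =i pred0.

(** The power sums are linear in the weights, and Newton's identities translate to them and back. *)
Lemma polyfun_e_mulmx (T : Type) d (th : T -> 'I_d -> F) N
    (P : 'I_k -> 'rV[F]_r) (g : 'M[F]_r) (x : T -> 'I_k -> {mpoly F[n]}) :
  (forall i j, (i <= N)%N -> polyfun_mpoly th (fun v => e i (fun s => P s 0 j) (x v))) ->
  forall i j, (i <= N)%N ->
    polyfun_mpoly th (fun v => e i (fun s => (P s *m g) 0 j) (x v)).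
Proof.
move=> he i j; apply: (polyfun_e_of_wpsum F0) => {}i iN.
apply: polyfun_mpoly_ext => [v|]; first by rewrite wpsum_mulmx.
apply: polyfun_mpoly_sum => l _; apply: polyfun_mpolyZ; first exact: polyfunC.
by apply: (polyfun_wpsum_of_e F0) iN => i'; apply: he.
Qed.

Variables (P : 'I_k -> 'rV[F]_r) (g : 'M[F]_r) (Nk N : nat).
Hypothesis gU : g \in unitmx.
Hypothesis NkN : (Nk <= N)%N.

Let P' s := P s *m g.

Lemma polyfun_Phi_mulmx c :
  polyfun (fun v => Phi N P v 0) (fun v => Phi (n := n) Nk P' v 0 c).
Proof.
apply: polyfun_Phi => i j iN; apply: (polyfun_e_mulmx (N := N)); last first.
  exact: leq_trans NkN.
by move=> *; apply: polyfun_e_Phi.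
Qed.

Hypothesis hP' : forall j (S : {set 'I_k}),
  S != finset.set0 -> \sum_(s in S) P' s 0 j != 0.
Hypothesis hst : Rstable F k Nk.

Lemma polyfun_e_Phi_generic i j :
  polyfun_mpoly (fun v => Phi Nk P' v 0)
    (fun v : 'I_k -> 'rV[F]_n => e i (fun s => P' s 0 j) (fun s => sym1 (v s))).
Proof.
move: i; apply: polyfun_e_stable hst _ => [S|i iN]; first exact: hP'.
exact: polyfun_e_Phi.
Qed.

(** At the weights [P'] all [e i] are polynomials in the first [Nk]; multiplying by the inverse of
    [g] then returns to the weights [P]. *)
Lemma polyfun_Phi_mulmxV c :
  polyfun (fun v => Phi Nk P' v 0) (fun v => Phi (n := n) N P v 0 c).
Proof.
apply: polyfun_Phi => i j iN.
have hP'i i' j' (h : (i' <= N)%N) := polyfun_e_Phi_generic i' j'.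
have := polyfun_e_mulmx (invmx g) hP'i j iN.
apply: polyfun_mpoly_ext => v; rewrite /e; apply: eq_bigr => f _; congr (_ *: _).
by apply: eq_bigr => s _; rewrite /P' mulmxK.
Qed.

End SymmetricCoordinates.

(** * Counting coordinates and comparing images *)

Lemma card_bmultinom n N : #|{: 'X_{1..n.+1 < N.+1}}| = 'C(n.+1 + N, n.+1).
Proof.
have deg_card d : (d <= N)%N ->
    #|[pred m : 'X_{1..n.+1 < N.+1} | mdeg m == d]| = 'C(d + n, d).
  move=> dN; rewrite -size_basis cardE -(size_map (@bmnm _ _)).
  apply/perm_size/uniq_perm; first by rewrite map_inj_uniq ?enum_uniq //; apply: val_inj.
    exact: uniq_basis.
  move=> m; rewrite -basis_cover; apply/mapP/idP => [[m' + ->]|md].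
    by rewrite mem_enum inE.
  have hm : (mdeg m < N.+1)%N by rewrite ltnS (eqP md).
  by exists (BMultinom hm); rewrite // mem_enum inE.
rewrite -sum1_card (partition_big
  (fun m : 'X_{1..n.+1 < N.+1} => inord (mdeg m) : 'I_N.+1) predT) //=.
(* The counts of monomials of each degree [d] add up by the hockey-stick identity. *)
transitivity (\sum_(d < N.+1) 'C(d + n, d))%N.
  apply: eq_bigr => d _; rewrite -(deg_card d (leq_ord d)) -sum1_card.
  by apply: eq_bigl => m; rewrite inE -val_eqE /= (inordK (bmdeg m)).
elim: N {deg_card} => [|N IHN].
  by rewrite big_ord1 addn0 binn bin0.
rewrite big_ord_recr /= IHN [in RHS]addnS binS; congr (_ + _)%N.
by rewrite -bin_sub ?leq_addr // addKn; congr 'C(_, _); lia.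
Qed.

(** The 1 subtracted accounts for the constant monomial. *)
Lemma card_symIndex r n N : (0 < n)%N -> #|symIndex r n N| = (r * ('C(n + N, n) - 1))%N.
Proof.
case: n => // n _; rewrite card_prod card_ord card_sig; congr (_ * _)%N.
rewrite -card_bmultinom subn1 -(cardC1 bm0); apply: eq_card => m.
by rewrite !inE -val_eqE /= -mdeg_eq0 lt0n.
Qed.

Lemma isomorphic_images (F : fieldType) (T : Type) (Z : set T) n d
    (f : T -> 'rV[F]_n) (g : T -> 'rV[F]_d) :
  (forall c, polyfun (fun v => f v 0) (fun v => g v 0 c)) ->
  (forall c, polyfun (fun v => g v 0) (fun v => f v 0 c)) ->
  isomorphic [set f v | v in Z]%classic [set g v | v in Z]%classic.
Proof.
move=> /fin_all_exists[p hp] /fin_all_exists[q hq]; exists p, q.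
have fE v : polymap p (f v) = g v by apply/rowP => c; rewrite mxE hp.
have gE v : polymap q (g v) = f v by apply/rowP => c; rewrite mxE hq.
split=> [_ [v Zv <-]|_ [v Zv <-]|_ [v Zv <-]|_ [v Zv <-]]; rewrite ?(fE, gE) //.
- by exists v.
- by exists v.
Qed.

(** * Zariski closedness of [Delta] *)

Section DeltaClosed.

Variables (F : closedFieldType) (k r n : nat).
Hypothesis F0 : [pchar F] =i pred0.

Let point := 'I_k -> 'rV[F]_n.
Let p := #|{: 'I_k * 'I_n}|.

Definition coords (v : point) (c : 'I_p) : F :=
  v (enum_val c).1 0 (enum_val c).2.

Lemma polyfun_coords (s : 'I_k) (a : 'I_n) : polyfun coords (fun v => v s 0 a).
Proof.
apply: polyfun_ext (polyfun_coord _ (enum_rank (s, a))) => v.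
by rewrite /coords enum_rankK.
Qed.

Lemma polyfun_Phi_coords N (P : 'I_k -> 'rV[F]_r) c :
  polyfun coords (fun v => Phi N P v 0 c).
Proof.
apply: polyfun_Phi => i j _; apply: polyfun_e => s.
apply: polyfun_mpoly_sum => a _; apply: polyfun_mpolyZ; last exact: polyfun_mpolyC.
exact: polyfun_coords.
Qed.

(** This turns power sums in the symmetric algebra into power sums of the [a]-th coordinates of the
    points. *)
Lemma sym1_meval (v : 'rV[F]_n) a : (sym1 v).@[fun b => (b == a)%:R] = v 0 a.
Proof.
rewrite raddf_sum (bigD1 a) //= mevalZ mevalXU eqxx mulr1 big1 ?addr0 // => b.
by move=> /negPf ba; rewrite mevalZ mevalXU ba mulr0.
Qed.

Variables (X : set 'rV[F]_n) (P : 'I_k -> 'rV[F]_r) (Nk : nat) (j0 : 'I_r).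
Hypothesis X_closed : closed_subvariety X.
Hypothesis hP : forall j (S : {set 'I_k}), S != finset.set0 -> \sum_(s in S) P s 0 j != 0.
Hypothesis hst : Rstable F k Nk.

Let phi (v : point) := Phi Nk P v 0.

Lemma polyfun_phi_wpsum i j :
  polyfun_mpoly phi (fun v => wpsum (fun s => P s 0 j) (fun s => sym1 (v s)) i.+1).
Proof.
apply: (polyfun_wpsum_of_e F0 (N := i.+1)) => [i' _|]; last by rewrite leqnn.
apply: polyfun_e_stable hst _ _ => [S|{}i iN]; first exact: hP.
exact: polyfun_e_Phi.
Qed.

Lemma Phi_finite : exists L (h : 'I_L -> {mpoly F[p]}), forall g : {mpoly F[p]},
  exists q : 'I_L -> {mpoly F[#|symIndex r n Nk|]},
  forall v, g.@[coords v] = \sum_m (q m).@[phi v] * (h m).@[coords v].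
Proof.
(* [G] is the ring of polynomials in the coordinates that factor through [phi]; it contains the
   power sums of each coordinate with the weights of [j0]. *)
pose G (g : {mpoly F[p]}) := polyfun phi (fun v => g.@[coords v]).
have GD a b : G a -> G b -> G (a + b).
  move=> ha hb; apply: polyfun_ext (polyfunD ha hb) => v; by rewrite mevalD.
have GM a b : G a -> G b -> G (a * b).
  move=> ha hb; apply: polyfun_ext (polyfunM ha hb) => v; by rewrite mevalM.
have GC a : G a%:MP.
  by apply: polyfun_ext (polyfunC _ a) => v; rewrite mevalC.
have [||c|E hE] := @mpoly_finite_over_weighted_sums F p G _ _ (fun s => P s 0 j0)
  (fun (s : 'I_k) (a : 'I_n) => enum_rank (s, a)) GD GM GC.
- exact: hP.
- move=> a i.
  apply: polyfun_ext (polyfun_meval (fun b => (b == a)%:R) _ (polyfun_phi_wpsum i j0)).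
    move=> v; rewrite !raddf_sum; apply: eq_bigr => s _ /=.
    by rewrite !mevalZ !rmorphXn /= mevalXU sym1_meval /coords enum_rankK.
  by move=> v; apply: wpsum_sym1_homog.
- by exists (enum_val c).1, (enum_val c).2; rewrite -surjective_pairing enum_valK.
exists #|{: 'X_{1..p < E.+1}}|, (fun m => 'X_[bmnm (enum_val m)]) => g.
have [b [Gb ->]] := hE g.
have /fin_all_exists[q hq] m := Gb m.
exists (fun m => q (enum_val m)) => v; rewrite raddf_sum.
rewrite (reindex (@enum_val _ {: 'X_{1..p < E.+1}})) /=; last first.
  by exists enum_rank => m _; rewrite ?enum_valK ?enum_rankK.
by apply: eq_bigr => m _; rewrite mevalM hq.
Qed.

Lemma Delta_closed : closed_subvariety (Delta Nk P X).
Proof.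
pose Z := [set v : point | forall s, X (v s)]%classic.
exists [set q | forall v, Z v -> q.@[phi v] = 0]%classic.
apply/seteqP; split=> [_ [v Zv <-] q /(_ v Zv) //|y hy].
have [L [h hspan]] := Phi_finite.
have /fin_all_exists[f hf] := polyfun_Phi_coords (N := Nk) P.
(* The set [Z] is closed: an equation [q] of [X] imposed on the [s]-th point is the polynomial
   [q \mPo t] in the flattened coordinates. *)
have Zcl (al : 'I_p -> F) :
    (forall q : {mpoly F[p]}, (forall z, Z z -> q.@[coords z] = 0) -> q.@[al] = 0) ->
    exists2 z, Z z & coords z =1 al.
  move=> hal; exists (fun s => \row_a al (enum_rank (s, a))); last first.
    by move=> c; rewrite /coords mxE -surjective_pairing enum_valK.
  move=> s; have [I XI] := X_closed; rewrite XI => q Iq.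
  pose t := [tuple 'X_(enum_rank (s, a)) : {mpoly F[p]} | a < n].
  have tE (be : 'I_p -> F) : (q \mPo t).@[be] = q.@[fun a => be (enum_rank (s, a))].
    rewrite comp_mpoly_meval; apply: meval_eq => a.
    by rewrite tnth_mktuple mevalXU.
  have := hal (q \mPo t); rewrite tE => hq.
  rewrite -hq => [|z Zz]; first by apply: meval_eq => a; rewrite mxE.
  rewrite tE; have := Zz s; rewrite XI => /(_ q Iq) <-.
  by apply: meval_eq => a; rewrite /coords enum_rankK.
have [z Zz phiz] := finite_image_closed (fun z i => hf i z) hspan Zcl (y := y 0) hy.
by exists z => //; apply/rowP.
Qed.

End DeltaClosed.

Theorem proposition5p5 (R : realType) (k r n : nat)
    (hk : (1 <= k)%N) (hr : (1 <= r)%N) (hn : (1 <= n)%N)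
    (X : set 'rV[R[i]]_n) (hX : closed_subvariety X)
    (P : 'I_k -> 'rV[R[i]]_r) (hP : circ P)
    (Nk : nat) (hNk : is_N R[i] k Nk) :
  exists N0 : nat, forall N : nat, (N0 <= N)%N ->
    embeds_in (Delta N P X) (r * ('C(n + Nk, n) - 1)).
Proof.
have F0 : [pchar R[i]] =i pred0 by apply: Num.Theory.pchar_num.
(* [Nk] itself serves as the bound: for each [N >= Nk] the image is isomorphic to one built with
   [Nk]. *)
have [hst _] := hNk; exists Nk => N NkN; rewrite -card_symIndex //.
(* [U] lists the nonempty subset sums of the [P s], nonzero by [circ]; the generic [g] makes every
   coordinate of each of them nonzero. *)
pose U := map (fun B : {set 'I_k} => \sum_(s in B) P s)
  (enum [pred B | B != finset.set0]).
have [u /mapP[S + ->]|g [gU hg]] := exists_generic_basis (U := U) F0.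
  by rewrite mem_enum inE => /hP.
have hPg j (S : {set 'I_k}) : S != finset.set0 -> \sum_(s in S) (P s *m g) 0 j != 0.
  move=> S0; rewrite -summxE -mulmx_suml hg //.
  by apply/mapP; exists S; rewrite // mem_enum inE.
exists (Delta Nk (fun s => P s *m g) X); split.
  exact: (Delta_closed F0 (Ordinal hr)).
apply: isomorphic_images => c; first exact: polyfun_Phi_mulmx.
exact: polyfun_Phi_mulmxV.
Qed.
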